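(* Let $S$ be a four-holed sphere with a pants decomposition and dual graph, with eigenvalue parameters $e_1,\dots,e_5$ and twist parameter $t_1$ as described in the context. If the orientation of the interior edge $f_1$ (with parameters $(e_1,t_1)$) is reversed, then the new parameters $(e_1',t_1')$ of this edge are $$(e_1',t_1')=\left(e_1^{-1},\ \frac{e_1e_2-e_3}{e_1e_3-e_2}\cdot\frac{e_1e_5-e_4}{e_1e_4-e_5}\,t_1^{-1}\right).$$
   Context: Setting. $S$ is an oriented four-holed sphere, $\pi_1(S)=\langle\gamma_1,\dots,\gamma_5\mid\gamma_1\gamma_2\gamma_3=1,\ \gamma_1^{-1}\gamma_4\gamma_5=1\rangle$, where $\gamma_2,\dots,\gamma_5$ go around the four boundary components and $\gamma_1$ around the interior pants curve $c_1$, which cuts $S$ into pairs of pants $P_1$ (with $\pi_1$ generated by $\gamma_1,\gamma_2,\gamma_3$) and $P_2$ (generated by $\gamma_1,\gamma_4,\gamma_5$). The dual graph has an interior edge $f_1$ oriented from $P_1$ to $P_2$ and boundary edges $f_2,\dots,f_5$ oriented outward; the counterclockwise orders at its trivalent vertices are $(f_1,f_2,f_3)$ in $P_1$ and $(f_1,f_4,f_5)$ in $P_2$. $\rho:\pi_1(S)\to\mathrm{SL}(2,\mathbb{C})$ is a representation such that each $\rho(\gamma_i)$ has exactly two fixed points on $\mathbb{C}P^1$ and the restrictions of $\rho$ to $\langle\gamma_1,\gamma_2,\gamma_3\rangle$ and $\langle\gamma_1,\gamma_4,\gamma_5\rangle$ are irreducible (no common fixed point in $\mathbb{C}P^1$).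 The eigenvalue parameter $e_i$ is a chosen eigenvalue of $\rho(\gamma_i)$; $x_i$ (resp. $y_i$) is the fixed point given by the eigenvector for $e_i$ (resp. $e_i^{-1}$). The twist parameter $t_1\in\mathbb{C}^*$ is the unique number such that the matrix with eigenvalue $\sqrt{-t_1}$ at $x_1$ and $1/\sqrt{-t_1}$ at $y_1$ sends $x_2$ to $x_5$, i.e. $-t_1=\frac{(x_1-x_2)(y_1-x_5)}{(x_1-x_5)(y_1-x_2)}$. Reversing $f_1$: the roles of $P_1$ and $P_2$ are exchanged, i.e. $(\gamma_1,\gamma_2,\gamma_3,\gamma_4,\gamma_5)$ is replaced by $(\gamma_1^{-1},\gamma_4,\gamma_5,\gamma_2,\gamma_3)$. The new eigenvalue parameter is chosen to be $e_1'=e_1^{-1}$ (the eigenvalue of $\rho(\gamma_1^{-1})$ at the same fixed point $x_1$), and $t_1'$ is the number such that the matrix with eigenvalue $\sqrt{-t_1'}$ at $x_1$ and $1/\sqrt{-t_1'}$ at $y_1$ sends $x_4$ to $x_3$. *)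

(* Defs.v *)
From mathcomp Require Import all_boot all_order all_algebra.
From mathcomp Require Import complex reals.

Set Implicit Arguments.
Unset Strict Implicit.
Unset Printing Implicit Defensive.

Import GRing.Theory.
Local Open Scope ring_scope.

(* [f1] is the interior edge of the dual graph, [f2], ..., [f5] the boundary
   edges.  Families such as the generators [gamma_i], the eigenvalues [e_i] and
   the fixed points [x_i], [y_i] are functions on [edge]. *)
Inductive edge := f1 | f2 | f3 | f4 | f5.

(* Reversing [f1] exchanges the two pairs of pants, so the indices 2, 3 are
   exchanged with 4, 5; [a1'] is the entry of the new family at [f1]. *)
Definition reverse_f1 (T : Type) (a1' : T) (a : edge -> T) (i : edge) : T :=
  match i with
  | f1 => a1'
  | f2 => a f4
  | f3 => a f5
  | f4 => a f2
  | f5 => a f3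
  end.

Section FundamentalGroup.
Local Open Scope group_scope.

Inductive generated (G : groupType) (A : G -> Prop) : G -> Prop :=
  | generated_in g : A g -> generated A g
  | generated_1 : generated A 1
  | generatedM g h : generated A g -> generated A h -> generated A (g * h)
  | generatedV g : generated A g -> generated A g^-1.

Definition pants_relations (G : groupType) (g : edge -> G) : Prop :=
  g f1 * g f2 * g f3 = 1 /\ (g f1)^-1 * g f4 * g f5 = 1.

(* [G] is presented by the generators [g i] and the two relations above,
   expressed by the universal property of a presentation; this is
   pi_1 of the four-holed sphere with its marking by the pants decomposition. *)
Definition presents_pi1 (G : groupType) (g : edge -> G) : Prop :=
  [/\ pants_relations g,
      forall z : G, generated (fun y => exists i, y = g i) z
    & forall (H : groupType) (h : edge -> H), pants_relations h ->
        exists phi : {multiplicative G -> H}, forall i, phi (g i) = h i].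

Definition pants1_group (G : groupType) (g : edge -> G) : G -> Prop :=
  generated (fun y => [\/ y = g f1, y = g f2 | y = g f3]).

Definition pants2_group (G : groupType) (g : edge -> G) : G -> Prop :=
  generated (fun y => [\/ y = g f1, y = g f4 | y = g f5]).

Definition is_SL2_representation (F : fieldType) (G : groupType)
    (rho : G -> 'M[F]_2) : Prop :=
  [/\ rho 1 = 1%:M,
      forall g h, rho (g * h) = rho g *m rho h
    & forall g, \det (rho g) = 1%R].

End FundamentalGroup.

(* Points of the projective line are the lines through the origin in the space
   of column vectors of size 2, on which matrices act on the left. *)
Record proj_line (F : fieldType) : Type := ProjLine {
  line : {vspace 'cV[F]_2};
  dim_line : \dim line == 1%N
}.

Section ProjectiveAction.
Variable F : fieldType.
Implicit Types (A : 'M[F]_2) (p q : proj_line F).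

Definition sends A p q : Prop := (linfun (mulmx A) @: line p)%VS = line q.

Definition fixes A p : Prop := sends A p p.

Definition has_two_fixed_points A : Prop :=
  exists p q, p <> q /\ forall r, fixes A r <-> r = p \/ r = q.

Definition no_common_fixed_point (G : groupType) (rho : G -> 'M[F]_2)
    (H : G -> Prop) : Prop :=
  ~ exists p, forall g, H g -> fixes (rho g) p.

Definition is_eigenline A (a : F) p : Prop :=
  forall v, v \in line p -> A *m v = a *: v.

(* [e i] is an eigenvalue of [rho (g i)], with fixed point [x i], and [y i] is
   the fixed point for the other eigenvalue [(e i)^-1]. *)
Definition eigenvalue_parameters (G : groupType) (rho : G -> 'M[F]_2)
    (g : edge -> G) (e : edge -> F) (x y : edge -> proj_line F) : Prop :=
  forall i, is_eigenline (rho (g i)) (e i) (x i)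
         /\ is_eigenline (rho (g i)) (e i)^-1 (y i).

(* [s] is a square root of [- t]; the choice of the root is irrelevant, since
   it only changes [A] by a sign. *)
Definition twist_parameter (x y : edge -> proj_line F) (t : F) : Prop :=
  t != 0 /\
  exists (s : F) (A : 'M[F]_2),
    [/\ s ^+ 2 = - t, is_eigenline A s (x f1), is_eigenline A s^-1 (y f1)
      & sends A (x f2) (x f5)].

End ProjectiveAction.

(* Main.v *)
Require Import Defs.
From mathcomp Require Import all_boot all_order all_algebra.
From mathcomp Require Import complex reals.
From mathcomp Require Import ring.
Import GRing.Theory.
Local Open Scope ring_scope.

Set Implicit Arguments.
Unset Strict Implicit.
Unset Printing Implicit Defensive.

(** Let v_1, w_1 and v_i span the fixed points x_1, y_1 and x_i.  Since
    rho(gamma_2) preserves the area form [u, v] of the plane and maps v_3 to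
    e_3^-1 rho(gamma_1)^-1 v_3, one has
    e_3 [v_2, v_3] = e_2 [v_2, rho(gamma_1)^-1 v_3]; expanding this in the
    eigenbasis (v_1, w_1) of rho(gamma_1) expresses the cross-ratio of
    (x_1, y_1; x_2, x_3) through e_1, e_2, e_3.  The twist parameters are minus
    the cross-ratios of (x_1, y_1; x_2, x_5) and (x_1, y_1; x_4, x_3), so their
    product is a product of two cross-ratios, one for each pair of pants.
    Irreducibility keeps x_2, ..., x_5 away from x_1 and y_1. *)

(** * The area form on the plane *)

Section AreaForm.
Variable F : fieldType.
Implicit Types (A : 'M[F]_2) (u v w x y : 'cV[F]_2).

(** The determinant of the matrix with columns [u] and [v]. *)
Definition area u v : F := u 0 0 * v 1 0 - u 1 0 * v 0 0.

Lemma det_mx22 A : \det A = A 0 0 * A 1 1 - A 0 1 * A 1 0.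
Proof.
rewrite (expand_det_row _ 0) !big_ord_recl big_ord0 addr0.
rewrite /cofactor !det_mx11 !mxE /= expr0 expr1 mul1r mulN1r mulrN.
by congr (_ * A _ _ - A _ _ * A _ _); apply/val_inj.
Qed.

Lemma mulmx_cV2 A v i : (A *m v) i 0 = A i 0 * v 0 0 + A i 1 * v 1 0.
Proof.
rewrite mxE !big_ord_recl big_ord0 addr0.
by rewrite (_ : lift ord0 ord0 = 1) //; apply/val_inj.
Qed.

Lemma areaC u v : area u v = - area v u.
Proof. by rewrite /area; ring. Qed.

Lemma area_id u : area u u = 0.
Proof. by rewrite /area; ring. Qed.

Lemma areaZl a u v : area (a *: u) v = a * area u v.
Proof. by rewrite /area !mxE; ring. Qed.

Lemma areaZr a u v : area u (a *: v) = a * area u v.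
Proof. by rewrite /area !mxE; ring. Qed.

Lemma areaDr u v w : area w (u + v) = area w u + area w v.
Proof. by rewrite /area !mxE; ring. Qed.

(** The linear form [area _ u] as a row; rank-one products with it build a matrix with prescribed
    eigenlines. *)
Definition area_row u : 'rV[F]_2 := \row_j (if j == 0 then u 1 0 else - u 0 0).

Lemma mul_area_row u v : area_row u *m v = (area v u)%:M.
Proof.
apply/matrixP=> i j; rewrite !ord1 !mxE !big_ord_recl big_ord0 !mxE /= /area.
rewrite (_ : lift ord0 ord0 = 1); last exact/val_inj.
by rewrite mulr1n; ring.
Qed.

Lemma area_mulmx A u v : area (A *m u) (A *m v) = \det A * area u v.
Proof. by rewrite /area !mulmx_cV2 det_mx22; ring. Qed.

Lemma cV2P u v : u 0 0 = v 0 0 -> u 1 0 = v 1 0 -> u = v.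
Proof.
move=> h0 h1; apply/matrixP=> i j; rewrite (ord1 j).
by case: i => [[|[|//]] hi]; [move: h0 | move: h1]; congr (u _ _ = v _ _);
  apply/val_inj.
Qed.

(** Cramer's rule, freed of division so that [x] and [y] may be dependent. *)
Lemma area_expand x y v : area x y *: v = area v y *: x + area x v *: y.
Proof. by apply: cV2P; rewrite /area !mxE; ring. Qed.

Lemma area_mulmx_eigen A a b x y u v :
    A *m x = a *: x -> A *m y = b *: y ->
  area x y * area u (A *m v)
    = a * (area v y * area u x) + b * (area x v * area u y).
Proof.
move=> hx hy; rewrite -areaZr scalemxAr area_expand.
by rewrite mulmxDr -!scalemxAr hx hy areaDr !areaZr; ring.
Qed.

Lemma area_eq0 u v : u != 0 -> (area u v == 0) = (v \in <[u]>%VS).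
Proof.
move=> u0; apply/idP/idP=> [/eqP uv|/vlineP[k ->]]; last first.
  by rewrite areaZr area_id mulr0.
(* A standard basis vector, chosen by which coordinate of [u] is nonzero, completes [u] to a
   basis. *)
have [w wu] : exists w, area u w != 0.
  have [u00|u00] := eqVneq (u 0 0) 0; last first.
    by exists (delta_mx 1 0); rewrite /area !mxE /= mulr1 mulr0 subr0.
  exists (delta_mx 0 0); rewrite /area !mxE /= mulr0 mulr1 sub0r oppr_eq0.
  by apply: contra_neq u0 => u10; apply: cV2P; rewrite ?u00 ?u10 mxE.
apply/vlineP; exists (area v w / area u w).
apply: (scalerI wu); rewrite area_expand uv scale0r addr0 scalerA.
by rewrite mulrCA divff ?mulr1.
Qed.

End AreaForm.

(** * Points of the projective line, eigenlines and cross-ratios *)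

Section ProjectiveLine.
Variable F : fieldType.
Implicit Types (A : 'M[F]_2) (p q : proj_line F) (a b : F).

Definition rep p : 'cV[F]_2 := vpick (line p).

Lemma rep_neq0 p : rep p != 0.
Proof. by rewrite vpick0 -dimv_eq0 (eqP (dim_line p)). Qed.

Lemma line_rep p : line p = <[rep p]>%VS.
Proof.
apply/eqP; rewrite eq_sym eqEdim -memvE memv_pick /=.
by rewrite dim_vline rep_neq0 (eqP (dim_line p)).
Qed.

Lemma proj_line_inj p q : line p = line q -> p = q.
Proof.
by case: p q => [U hU] [V hV] /= UV; subst V; congr ProjLine; apply: bool_irrelevance.
Qed.

Lemma vline_eq (u v : 'cV[F]_2) :
  u != 0 -> v != 0 -> (<[u]> == <[v]>)%VS = (u \in <[v]>%VS).
Proof. by move=> u0 v0; rewrite eqEdim !dim_vline u0 v0 andbT memvE. Qed.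

Lemma area_rep_eq0 p q : area (rep p) (rep q) = 0 <-> p = q.
Proof.
split=> [/eqP|->]; last exact: area_id.
rewrite area_eq0 ?rep_neq0 // -vline_eq ?rep_neq0 // => /eqP qp.
by apply/esym/proj_line_inj; rewrite !line_rep.
Qed.

Lemma is_eigenlineP A a p : is_eigenline A a p <-> A *m rep p = a *: rep p.
Proof.
split=> [h|h v]; first by apply: h; rewrite memv_pick.
by rewrite line_rep => /vlineP[k ->]; rewrite -scalemxAr h !scalerA mulrC.
Qed.

(** Collinearity is the vanishing of the area. If [A] killed [rep p], the area would vanish although
    the image is the zero subspace, not a line. *)
Lemma sendsP A p q :
  A *m rep p != 0 -> sends A p q <-> area (A *m rep p) (rep q) = 0.
Proof.
move=> Ap0; rewrite /sends !line_rep limg_line lfunE /=.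
split=> [pq|/eqP].
  by apply/eqP; rewrite area_eq0 // pq memv_line.
rewrite area_eq0 // -vline_eq ?rep_neq0 // => /eqP-> //.
Qed.

Lemma fixes_eigenline A p : fixes A p -> exists a, is_eigenline A a p.
Proof.
rewrite /fixes /sends line_rep limg_line lfunE /= => h.
have /vlineP[a ha] : A *m rep p \in <[rep p]>%VS by rewrite -h memv_line.
by exists a; apply/is_eigenlineP.
Qed.

Lemma eigenline_fixes A a p : a != 0 -> is_eigenline A a p -> fixes A p.
Proof.
move=> a0 /is_eigenlineP h; apply/sendsP; rewrite h ?areaZl ?area_id ?mulr0 //.
by rewrite scaler_eq0 negb_or a0 rep_neq0.
Qed.

Lemma eigenvalue_neq0 A a p : \det A = 1 -> is_eigenline A a p -> a != 0.
Proof.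
move=> dA /is_eigenlineP h; apply: contra_neq (rep_neq0 p) => a0.
have uA : A \in unitmx by rewrite unitmxE dA unitr1.
by rewrite -(mulKmx uA (rep p)) h a0 scale0r mulmx0.
Qed.

Lemma eigenlines_neq A a b p q :
  a != b -> is_eigenline A a p -> is_eigenline A b q -> p <> q.
Proof.
move=> ab /is_eigenlineP hp /is_eigenlineP hq pq; subst q.
move: (rep_neq0 p); apply/negP/negPn.
move/eqP: hq; rewrite hp -subr_eq0 -scalerBl scaler_eq0 subr_eq0.
by rewrite (negbTE ab).
Qed.

Lemma eigenvalue_unique A a b p :
  is_eigenline A a p -> is_eigenline A b p -> a = b.
Proof.
move=> ha hb; apply/eqP/negPn/negP => ab.
exact: (eigenlines_neq ab ha hb).
Qed.

Lemma exists_proj_line (u : 'cV[F]_2) :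
  u != 0 -> exists p, line p = <[u]>%VS.
Proof.
move=> u0; have h : \dim <[u]> == 1%N by rewrite dim_vline u0.
by exists (ProjLine h).
Qed.

(** If the two eigenvalues coincided, the second fixed point would make the
    matrix scalar, and scalar matrices fix every point. *)
Lemma two_fixed_points_eigenvalue A a p :
  \det A = 1 -> has_two_fixed_points A -> is_eigenline A a p -> a != a^-1.
Proof.
move=> dA [q1 [q2 [q12 hq]]] hp.
have a0 := eigenvalue_neq0 dA hp.
have [q pq fq] : exists2 q, p <> q & fixes A q.
  have /hq[pq|pq] := eigenline_fixes a0 hp.
    by exists q2; [rewrite pq | apply/hq; right].
  by exists q1; [rewrite pq => /esym | apply/hq; left].
have [b hb] := fixes_eigenline fq.
have pq0 : area (rep p) (rep q) != 0 by apply/eqP=> /area_rep_eq0.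
move/is_eigenlineP: (hp) => hp'; move/is_eigenlineP: (hb) => hb'.
(* [A] preserves the area of the two eigenvectors and multiplies it by [a * b]. *)
have ab : a * b = 1.
  apply: (mulIf pq0); rewrite mul1r -mulrA.
  by rewrite -areaZr -areaZl -hp' -hb' area_mulmx dA mul1r.
apply/eqP=> aV; have ba : b = a by rewrite [RHS]aV -[LHS](mulKf a0) ab mulr1.
subst b.
(* The sum of the two eigenvectors spans a third fixed point [r]. *)
have s0 : rep p + rep q != 0.
  apply: contra_neq pq0 => /eqP; rewrite addr_eq0 => /eqP->.
  by rewrite -scaleN1r areaZl area_id mulr0.
have [r hr] := exists_proj_line s0.
have /hq : fixes A r.
  apply: (eigenline_fixes a0) => v; rewrite hr => /vlineP[k ->].
  by rewrite -scalemxAr mulmxDr hp' hb' -scalerDr !scalerA mulrC.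
have nrp : r <> p.
  move=> /esym E; move/eqP: pq0; apply.
  have : rep p + rep q \in line p by rewrite (congr1 (@line F) E) hr memv_line.
  rewrite line_rep -area_eq0 ?rep_neq0 // areaDr area_id add0r.
  by move/eqP.
have nrq : r <> q.
  move=> /esym E; move/eqP: pq0; apply.
  have : rep p + rep q \in line q by rewrite (congr1 (@line F) E) hr memv_line.
  rewrite line_rep -area_eq0 ?rep_neq0 // areaDr area_id addr0 areaC.
  by rewrite oppr_eq0 => /eqP.
have /hq := eigenline_fixes a0 hp; have /hq := fq.
by case=> E1 [] E2 [] E3; congruence.
Qed.

(** By the first equation, [- t] is the cross-ratio
    ((x_1-x_2)(y_1-x_5)) / ((x_1-x_5)(y_1-x_2)) of the text. *)
Lemma twist_parameterP (x y : edge -> proj_line F) (t : F) :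
    (exists s, s ^+ 2 = - t) -> x f1 <> y f1 -> x f2 <> y f1 ->
  twist_parameter x y t <->
  t != 0 /\ - t * (area (rep (x f2)) (rep (y f1)) * area (rep (x f1)) (rep (x f5)))
         = area (rep (x f1)) (rep (x f2)) * area (rep (x f5)) (rep (y f1)).
Proof.
move=> sq xy x2y.
have xy0 : area (rep (x f1)) (rep (y f1)) != 0 by apply/eqP=> /area_rep_eq0.
have x2y0 : area (rep (x f2)) (rep (y f1)) != 0 by apply/eqP=> /area_rep_eq0.
(* For every [A] with these eigenlines, expand the image of [x f2] in the eigenbasis and test its
   collinearity with [x f5]. *)
have sends_eq (s : F) A : s != 0 ->
    is_eigenline A s (x f1) -> is_eigenline A s^-1 (y f1) ->
  sends A (x f2) (x f5) <->
  s ^+ 2 * (area (rep (x f2)) (rep (y f1)) * area (rep (x f1)) (rep (x f5)))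
         = area (rep (x f1)) (rep (x f2)) * area (rep (x f5)) (rep (y f1)).
  move=> s0 /is_eigenlineP hx /is_eigenlineP hy.
  have E u := area_mulmx_eigen u (rep (x f2)) hx hy.
  (* Pairing the image with [rep (y f1)] isolates its component along [x f1], which is nonzero. *)
  have Ax2 : A *m rep (x f2) != 0.
    apply: contra_neq x2y0 => A0; have := E (rep (y f1)).
    rewrite A0 area_id -(scale0r (rep (x f2))) areaZr mul0r !mulr0 addr0.
    move/esym/eqP; rewrite (areaC (rep (y f1)) (rep (x f1))) !mulf_eq0 (negbTE s0).
    by rewrite oppr_eq0 (negbTE xy0) orbF => /eqP.
  rewrite (sendsP _ Ax2) areaC; move: {E}(E (rep (x f5))).
  rewrite (areaC _ (rep (x f1))); set c := area _ (A *m _) => E.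
  (* The factor [s] clears [s^-1] and turns the ratio of the eigenvalues into [s ^+ 2]. *)
  have {}E : - s * (area (rep (x f1)) (rep (y f1)) * c) =
    s ^+ 2 * (area (rep (x f2)) (rep (y f1)) * area (rep (x f1)) (rep (x f5)))
    - area (rep (x f1)) (rep (x f2)) * area (rep (x f5)) (rep (y f1)).
    by rewrite E; field.
  split=> [/eqP|/eqP]; rewrite ?oppr_eq0 => h.
    by apply/eqP; rewrite -subr_eq0 -E (eqP h) !mulr0.
  apply/eqP; rewrite -subr_eq0 -E in h.
  by move: h; rewrite !mulf_eq0 !oppr_eq0 (negbTE s0) (negbTE xy0).
have s_neq0 s : t != 0 -> s ^+ 2 = - t -> s != 0.
  by move=> t0 st; apply: contra_neq t0 => s0; rewrite -[t]opprK -st s0 expr0n oppr0.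
split=> [[t0 [s [A [st hx hy]]]]|[t0 h]].
  by rewrite -st => /(sends_eq _ _ (s_neq0 _ t0 st) hx hy).
split=> //; have [s st] := sq; have s0 := s_neq0 _ t0 st.
pose X := rep (x f1); pose Y := rep (y f1).
(* The diagonal matrix [s], [s^-1] in the basis [X], [Y], with coordinates read off Cramer's rule;
   the minus sign comes from [area v X = - area X v]. *)
pose A := (area X Y)^-1 *: (s *: (X *m area_row Y) - s^-1 *: (Y *m area_row X)).
have AE v : area X Y *: (A *m v) = (s * area v Y) *: X + (s^-1 * area X v) *: Y.
  rewrite -scalemxAl scalerA divff // scale1r mulmxBl -!scalemxAl -!mulmxA.
  by rewrite !mul_area_row !mul_mx_scalar !scalerA -scaleNr -mulrN -areaC.
have hx : is_eigenline A s (x f1).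
  apply/is_eigenlineP/(scalerI xy0); rewrite AE area_id mulr0 scale0r addr0.
  by rewrite scalerA mulrC.
have hy : is_eigenline A s^-1 (y f1).
  apply/is_eigenlineP/(scalerI xy0); rewrite AE area_id mulr0 scale0r add0r.
  by rewrite scalerA mulrC.
by exists s, A; split=> //; apply/(sends_eq _ _ s0 hx hy); rewrite st.
Qed.

End ProjectiveLine.

(** * Representations of the group of one pair of pants *)

Section PairOfPants.
Variables (F : fieldType) (G : groupType) (rho : G -> 'M[F]_2).
Hypothesis Hrho : is_SL2_representation rho.

Lemma rep_mulVmx g : rho g^-1%g *m rho g = 1%:M.
Proof. by case: Hrho => r1 rM _; rewrite -rM mulVg r1. Qed.

Lemma fixesM g h p :
  fixes (rho g) p -> fixes (rho h) p -> fixes (rho (g * h)%g) p.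
Proof.
case: Hrho => _ rM _; rewrite /fixes /sends !line_rep !limg_line !lfunE /= rM.
move=> hg /(congr1 (fun U => linfun (mulmx (rho g)) @: U)%VS).
by rewrite !limg_line !lfunE /= hg mulmxA.
Qed.

Lemma fixesV g p : fixes (rho g) p -> fixes (rho g^-1%g) p.
Proof.
rewrite /fixes /sends !line_rep !limg_line !lfunE /=.
move=> /(congr1 (fun U => linfun (mulmx (rho g^-1%g)) @: U)%VS).
by rewrite !limg_line !lfunE /= mulmxA rep_mulVmx mul1mx.
Qed.

Lemma fixes1 p : fixes (rho 1%g) p.
Proof.
by case: Hrho => r1 _ _; rewrite /fixes /sends line_rep limg_line lfunE /= r1 mul1mx.
Qed.

Lemma generated_fixes (S : G -> Prop) p :
    (forall g, S g -> fixes (rho g) p) ->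
  forall g, generated S g -> fixes (rho g) p.
Proof.
move=> hS g; elim=> {g} [g /hS // | | g h _ fg _ fh | g _ fg].
- exact: fixes1.
- exact: fixesM.
- exact: fixesV.
Qed.

Lemma is_eigenlineV g a p :
  is_eigenline (rho g) a p -> is_eigenline (rho g^-1%g) a^-1 p.
Proof.
move=> hp; case: Hrho => _ _ rD.
have a0 := eigenvalue_neq0 (rD g) hp; move/is_eigenlineP: hp => hp.
apply/is_eigenlineP; apply: (scalerI a0).
by rewrite scalemxAr -hp mulmxA rep_mulVmx mul1mx scalerA divff // scale1r.
Qed.

Lemma is_eigenline_fixes g a p : is_eigenline (rho g) a p -> fixes (rho g) p.
Proof.
by case: Hrho => _ _ rD h; apply: eigenline_fixes (eigenvalue_neq0 (rD g) h) h.
Qed.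

Variables (g1 g2 g3 : G) (e1 e2 e3 : F) (x1 y1 x2 x3 : proj_line F).
Hypothesis g123 : (g1 * g2 * g3 = 1)%g.
Hypothesis e1_neqV : e1 != e1^-1.
Hypotheses (hx1 : is_eigenline (rho g1) e1 x1)
  (hy1 : is_eigenline (rho g1) e1^-1 y1)
  (hx2 : is_eigenline (rho g2) e2 x2) (hx3 : is_eigenline (rho g3) e3 x3).
Hypothesis irr :
  forall p, ~ [/\ fixes (rho g1) p, fixes (rho g2) p & fixes (rho g3) p].

(** As the three generators have product 1, a point fixed by two of them is fixed by the third,
    against irreducibility. *)
Lemma pants_boundary_neq z :
  fixes (rho g1) z -> x2 <> z /\ x3 <> z.
Proof.
move=> f1z; split=> xz; apply: (@irr z); split=> //.
- by rewrite -xz; apply: is_eigenline_fixes hx2.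
- have -> : g3 = ((g1 * g2)^-1)%g.
    by apply: (mulgI (g1 * g2)%g); rewrite g123 mulgV.
  by apply/fixesV/fixesM => //; rewrite -xz; apply: is_eigenline_fixes hx2.
- have -> : g2 = (g1^-1 * g3^-1)%g.
    apply: (mulgI g1); apply: (mulIg g3).
    by rewrite g123 mulgA mulgV mul1g mulVg.
  by apply: fixesM; apply: fixesV => //; rewrite -xz; apply: is_eigenline_fixes hx3.
- by rewrite -xz; apply: is_eigenline_fixes hx3.
Qed.

Lemma pants_cross_ratio :
  e1 * (e1 * e2 - e3)
    * (area (rep x2) (rep y1) * area (rep x1) (rep x3))
  = (e2 - e1 * e3)
    * (area (rep x1) (rep x2) * area (rep x3) (rep y1)).
Proof.
case: Hrho => r1 rM rD.
have e10 := eigenvalue_neq0 (rD g1) hx1; have e30 := eigenvalue_neq0 (rD g3) hx3.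
have hx := is_eigenlineV hx1; have hy := is_eigenlineV hy1; rewrite invrK in hy.
move/is_eigenlineP: hx => hx; move/is_eigenlineP: hy => hy.
move/is_eigenlineP: (hx2) => h2; move/is_eigenlineP: (hx3) => h3.
(* Apply [g2 * g3 = g1^-1] to the eigenvector of [g3]. *)
have h23 : e3 *: (rho g2 *m rep x3) = rho g1^-1%g *m rep x3.
  have -> : g1^-1%g = (g2 * g3)%g.
    by apply: (mulgI g1); rewrite mulgV mulgA g123.
  by rewrite rM -mulmxA h3 scalemxAr.
have xy0 : area (rep x1) (rep y1) != 0.
  by apply/eqP=> /area_rep_eq0; apply: eigenlines_neq hx1 hy1.
have E := area_mulmx_eigen (rep x2) (rep x3) hx hy.
have E' : e3 * area (rep x2) (rep x3) = e2 * area (rep x2) (rho g1^-1%g *m rep x3).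
  by rewrite -h23 areaZr mulrCA -(areaZl e2) -h2 area_mulmx rD mul1r.
(* The left side of [E'] is expanded in the same eigenbasis as the right side. *)
have E0 : area (rep x1) (rep y1) * area (rep x2) (rep x3) =
  area (rep x3) (rep y1) * area (rep x2) (rep x1)
  + area (rep x1) (rep x3) * area (rep x2) (rep y1).
  by rewrite -areaZr area_expand areaDr !areaZr.
have := congr1 ( *%R (area (rep x1) (rep y1))) E'.
rewrite mulrCA E0 mulrCA E (areaC (rep x2) (rep x1)) => H.
move: (congr1 ( *%R e1) H).
set a2 := area (rep x2) _; set a3 := area (rep x3) _.
set b2 := area _ (rep x2); set b3 := area _ (rep x3) => {}H.
apply/eqP; rewrite -subr_eq0; apply/eqP.
transitivity (e1 * (e2 * (e1^-1 * (a3 * - b2) + e1 * (b3 * a2)))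
   - e1 * (e3 * (a3 * - b2 + b3 * a2))); first by field.
by rewrite H subrr.
Qed.

(** Keeps a denominator of the final formula nonzero. If [e2 = e1 * e3], the cross-ratio relation
    with its nonzero areas forces [e3 = e1 * e2], so [e1] squares to 1. *)
Lemma pants_eigenvalues_neq : e1 * e3 - e2 != 0.
Proof.
case: Hrho => r1 rM rD.
have e10 := eigenvalue_neq0 (rD g1) hx1.
have [_ x3x] := pants_boundary_neq (is_eigenline_fixes hx1).
have [x2y _] := pants_boundary_neq (is_eigenline_fixes hy1).
apply/eqP => e13; have := pants_cross_ratio.
rewrite -[e2 - _]opprB e13 oppr0 mul0r => /eqP.
rewrite !mulf_eq0 (negbTE e10).
have -> : area (rep x2) (rep y1) == 0 = false.
  by apply/eqP=> /area_rep_eq0.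
have -> : area (rep x1) (rep x3) == 0 = false.
  by apply/eqP=> /area_rep_eq0 /esym.
rewrite !orbF /= subr_eq0 => /eqP e12.
move/eqP: e13; rewrite subr_eq0 => /eqP e13.
move/eqP: e1_neqV; apply; apply: (mulfI e10); rewrite divff //.
by apply: (mulIf (eigenvalue_neq0 (rD g3) hx3)); rewrite mul1r -mulrA e13.
Qed.

End PairOfPants.

(** Here [ai] stands for the area of x_i and y_1, and [bi] for that of x_1 and x_i. The second pants
    relation carries [e1^-1] because its first generator is the inverse of gamma_1. The right-hand
    side is the new twist parameter. *)
Lemma twist_product (F : fieldType) (e1 e2 e3 e4 e5 t a2 a3 a4 a5 b2 b3 b4 b5 : F) :
    e1 != 0 -> e1 * e3 - e2 != 0 -> e1^-1 * e5 - e4 != 0 ->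
    a2 != 0 -> a4 != 0 -> b3 != 0 -> b5 != 0 -> t != 0 ->
    e1 * (e1 * e2 - e3) * (a2 * b3) = (e2 - e1 * e3) * (b2 * a3) ->
    e1^-1 * (e1^-1 * e4 - e5) * (a4 * b5) = (e4 - e1^-1 * e5) * (b4 * a5) ->
    - t * (a2 * b5) = b2 * a5 ->
  (e1 * e2 - e3) / (e1 * e3 - e2) * ((e1 * e5 - e4) / (e1 * e4 - e5)) * t^-1
  = - (b4 * a3 / (a4 * b3)).
Proof.
move=> e10 d1 d2 a2n a4n b3n b5n t0 H1 H2 T.
have d2' : e1 * e4 - e5 != 0.
  by rewrite -oppr_eq0 opprB -(mulVKf e10 e5) -mulrBr mulf_neq0.
(* Each eigenvalue quotient is minus a cross-ratio, up to a power of [e1]; the powers in [k1] and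
   [k2] cancel. *)
have k1 : (e1 * e2 - e3) / (e1 * e3 - e2) = - (b2 * a3) / (e1 * (a2 * b3)).
  apply/eqP; rewrite eqr_div ?mulf_neq0 //; apply/eqP.
  by rewrite mulrCA mulrA H1; ring.
have k2 : (e1 * e5 - e4) / (e1 * e4 - e5) = - (e1 * (b4 * a5)) / (a4 * b5).
  apply/eqP; rewrite eqr_div ?mulf_neq0 //; apply/eqP.
  transitivity (- (e1 * e1) * (e1^-1 * (e1^-1 * e4 - e5) * (a4 * b5))); first by field.
  by rewrite H2; field.
have ba : b2 * a5 != 0 by rewrite -T !mulf_neq0 // oppr_eq0.
have -> : t = - (b2 * a5) / (a2 * b5) by rewrite -T; field; apply/andP.
by rewrite k1 k2; field; rewrite oppr_eq0 ba e10 a2n b3n a4n b5n.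
Qed.

(** * The parameters of the reversed interior edge *)

Theorem proposition10p3 (R : realType) (G : groupType) (gamma : edge -> G)
    (rho : G -> 'M[R[i]]_2) (e : edge -> R[i]) (x y : edge -> proj_line R[i])
    (t1 : R[i])
    (Hpi1 : presents_pi1 gamma)
    (Hrho : is_SL2_representation rho)
    (Hfix : forall i : edge, has_two_fixed_points (rho (gamma i)))
    (Hirr1 : no_common_fixed_point rho (pants1_group gamma))
    (Hirr2 : no_common_fixed_point rho (pants2_group gamma))
    (He : eigenvalue_parameters rho gamma e x y)
    (Ht : twist_parameter x y t1) :
  forall e1' t1' : R[i],
    (eigenvalue_parameters rho
       (reverse_f1 (gamma f1)^-1%g gamma) (reverse_f1 e1' e)
       (reverse_f1 (x f1) x) (reverse_f1 (y f1) y)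
     /\ twist_parameter (reverse_f1 (x f1) x) (reverse_f1 (y f1) y) t1')
    <->
    (e1', t1') =
      ((e f1)^-1,
       (e f1 * e f2 - e f3) / (e f1 * e f3 - e f2)
       * ((e f1 * e f5 - e f4) / (e f1 * e f4 - e f5)) * t1^-1).
Proof.
move=> e1' t1'.
have [_ _ rD] := Hrho; have [[rel1 rel2] _ _] := Hpi1.
have [hx1 hy1] := He f1; have [hx2 _] := He f2; have [hx3 _] := He f3.
have [hx4 _] := He f4; have [hx5 _] := He f5.
have e1V := two_fixed_points_eigenvalue (rD _) (Hfix f1) hx1.
have e10 := eigenvalue_neq0 (rD _) hx1.
have e1V' : (e f1)^-1 != (e f1)^-1^-1 by rewrite invrK eq_sym.
have hxV := is_eigenlineV Hrho hx1; have hyV := is_eigenlineV Hrho hy1.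
have irr1 p : ~ [/\ fixes (rho (gamma f1)) p, fixes (rho (gamma f2)) p
    & fixes (rho (gamma f3)) p].
  move=> [q1 q2 q3]; apply: Hirr1; exists p; apply: (generated_fixes Hrho).
  by move=> g [] ->.
(* Rephrased for the inverse of [gamma f1], so that the lemmas on a pair of pants apply to
   [rel2]. *)
have irr2 p : ~ [/\ fixes (rho (gamma f1)^-1%g) p, fixes (rho (gamma f4)) p
    & fixes (rho (gamma f5)) p].
  move=> [/(fixesV Hrho) + q2 q3]; rewrite invgK => q1.
  apply: Hirr2; exists p; apply: (generated_fixes Hrho).
  by move=> g [] ->.
have fx := is_eigenline_fixes Hrho hx1; have fy := is_eigenline_fixes Hrho hy1.
have fxV := fixesV Hrho fx; have fyV := fixesV Hrho fy.
have [_ x3x] := pants_boundary_neq Hrho rel1 hx2 hx3 irr1 fx.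
have [x2y x3y] := pants_boundary_neq Hrho rel1 hx2 hx3 irr1 fy.
have [x4x x5x] := pants_boundary_neq Hrho rel2 hx4 hx5 irr2 fxV.
have [x4y _] := pants_boundary_neq Hrho rel2 hx4 hx5 irr2 fyV.
have N1 := pants_eigenvalues_neq Hrho rel1 e1V hx1 hy1 hx2 hx3 irr1.
have N2 := pants_eigenvalues_neq Hrho rel2 e1V' hxV hyV hx4 hx5 irr2.
have C1 := pants_cross_ratio Hrho rel1 e1V hx1 hy1 hx2 hx3.
have C2 := pants_cross_ratio Hrho rel2 e1V' hxV hyV hx4 hx5.
have SP t : exists s : R[i], s ^+ 2 = - t by exists (sqrtc (- t)); exact: sqr_sqrtc.
have xy : x f1 <> y f1 := eigenlines_neq e1V hx1 hy1.
have /twist_parameterP T1 := Ht.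
have [t10 {}T1] := T1 (SP _) xy x2y.
(* In the reversed family, the points at [f2] and [f5] are [x f4] and [x f3]. *)
have T2 := @twist_parameterP _ (reverse_f1 (x f1) x) (reverse_f1 (y f1) y) t1' (SP _) xy x4y.
rewrite /= in T2.
have nz (p q : proj_line R[i]) : p <> q -> area (rep p) (rep q) != 0.
  by move=> pq; apply/eqP=> /area_rep_eq0.
have a2 := nz _ _ x2y; have a3 := nz _ _ x3y.
have a4 := nz _ _ x4y.
have b3 := nz _ _ (fun E => x3x (esym E)).
have b4 := nz _ _ (fun E => x4x (esym E)); have b5 := nz _ _ (fun E => x5x (esym E)).
have K := twist_product e10 N1 N2 a2 a4 b3 b5 t10 C1 C2 T1.
have t1'E : - t1' * (area (rep (x f4)) (rep (y f1)) * area (rep (x f1)) (rep (x f3))) =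
    area (rep (x f1)) (rep (x f4)) * area (rep (x f3)) (rep (y f1)) <->
    t1' = (e f1 * e f2 - e f3) / (e f1 * e f3 - e f2)
       * ((e f1 * e f5 - e f4) / (e f1 * e f4 - e f5)) * t1^-1.
  rewrite K; split=> [<-|->]; field; exact/andP.
split=> [[E /T2[_ /t1'E->]]|[-> Et]].
  (* At [f1], both [e1'] and [(e f1)^-1] are the eigenvalue of the inverse of [gamma f1] on
     [x f1]. *)
  by congr pair; apply: (eigenvalue_unique (E f1).1 hxV).
split; first by case; [split | exact: (He f4) | exact: (He f5) | exact: (He f2) | exact: (He f3)].
apply/T2; split; last by apply/t1'E.
(* The new twist is nonzero, being minus a quotient of products of nonzero areas. *)
rewrite Et K oppr_eq0 !mulf_eq0 invr_eq0 !mulf_eq0.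
by rewrite (negbTE a3) (negbTE b4) (negbTE a4) (negbTE b3).
Qed.
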